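(* For each positive integer $n$ let $N_3=3(n+1)$ and let $b\in\mathbb{Z}_{N_3}$ with $b\equiv 1$ or $2\pmod 3$. Then, as $n\to\infty$, $$M_{3,1,n}(b)=-\frac{3^{n}}{n+1}(1+o(1)).$$ In particular, $M_{3,1,n}(b)<0$ for all $n>0$.
   Context: For a prime $p$ and positive integers $s,n$, put $N_p=(n+1)p$, $D_p=\{x\in\mathbb{Z}:1\leq x\leq pn+p-1,\ p\nmid x\}$, and for $b\in\mathbb{Z}_{N_p}$ let $M_{p,s,n}(b)=\sum (-1)^{|V_1|+\cdots+|V_s|}$, the sum over all $s$-tuples $(V_1,\ldots,V_s)$ of subsets of $D_p$ with $\sum_{i=1}^s\sum_{x\in V_i}x\equiv b\pmod{N_p}$. Equivalently, $M_{p,s,n}(b)$ is the sum of the coefficients of $q^i$, $i\equiv b\pmod{N_p}$, in $\prod_{j=0}^n\prod_{k=1}^{p-1}(1-q^{pj+k})^s$. *)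

(* Defs.v *)
From HB Require Import structures.
From mathcomp Require Import all_boot all_order all_algebra.
From mathcomp Require Import all_classical all_reals all_analysis.

Set Implicit Arguments.
Unset Strict Implicit.
Unset Printing Implicit Defensive.

Import Order.TTheory GRing.Theory Num.Theory.
Import numFieldNormedType.Exports.

Local Open Scope ring_scope.

Definition modulus (p n : nat) : nat := (n + 1) * p.

Definition D (p n : nat) : {set 'I_(p * n + p)} :=
  [set x : 'I_(p * n + p) | (1 <= x <= p * n + p - 1)%N && ~~ (p %| x)%N].

(* The type 'Z_m is the ring of integers modulo m only when 1 < m; this holds
   for m = modulus p n whenever p is prime. *)
Definition M (p s n : nat) (b : 'Z_(modulus p n)) : int :=
  \sum_(V : {ffun 'I_s -> {set 'I_(p * n + p)}} |
          [forall i, V i \subset D p n] &&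
          (\sum_(i < s) \sum_(x in V i) x == b %[mod modulus p n])%N)
     (-1) ^+ (\sum_(i < s) #|V i|)%N.

Arguments M p s n b : clear implicits.

(* Main.v *)
(* Let m = n + 1, N = 3 m and F(z) = \prod_(3 does not divide x < N) (1 - z^x).
   Discrete Fourier inversion at a primitive N-th root of unity w gives
     N M(b) = \sum_(j < N) w^(-j b) F(w^j).
   If z^N = 1 and z^3 has order e, grouping the exponents by their class modulo 3
   gives F(z) = ((1 - z^e) (1 - z^(2e)))^(m/e), which is 0 if z^e = 1 and 3^(m/e)
   otherwise, z^e being then a primitive cube root of unity.  The terms j = m and
   j = 2m add up to -3^m because 3 does not divide b, every other term is at most
   3^(m/2) in absolute value, and j = 0 and (for even m) j = N/2 contribute 0.
   Discarding j = N/2 is what makes the error smaller than 3^m also for m = 2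
   and m = 4. *)
Require Import Defs.
From HB Require Import structures.
From mathcomp Require Import all_boot all_order all_algebra all_field.
From mathcomp Require Import all_classical all_reals all_analysis.
From mathcomp Require Import ring zify.

Set Implicit Arguments.
Unset Strict Implicit.
Unset Printing Implicit Defensive.

Import Order.TTheory GRing.Theory Num.Theory.
Import numFieldNormedType.Exports.

Local Open Scope classical_set_scope.
Local Open Scope ring_scope.

(** * Products over powers of a root of unity *)

(** Evaluate the factorization of [X^e - 1] over the powers of [u] at [1/y] and scale by [y^e];
    hence the separate case [y = 0]. *)
Lemma prod_one_sub_prim_root (F : fieldType) (e : nat) (u y : F) :
  e.-primitive_root u -> \prod_(0 <= k < e) (1 - u ^+ k * y) = 1 - y ^+ e.
Proof.
move=> hu; have e_gt0 := prim_order_gt0 hu.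
have [->|y0] := eqVneq y 0.
  by rewrite expr0n gtn_eqF // subr0 big1 // => k _; rewrite mulr0 subr0.
have -> : \prod_(0 <= k < e) (1 - u ^+ k * y)
          = \prod_(0 <= k < e) (y * ('X - (u ^+ k)%:P).[y^-1]).
  by apply: eq_bigr => k _; rewrite hornerXsubC mulrBr divff // [y * _]mulrC.
rewrite big_split prodr_const_nat subn0 -horner_prod factor_Xn_sub_1 //=.
by rewrite !hornerE exprVn mulrBr mulr1 divff ?expf_neq0.
Qed.

(** The range splits into [q] full periods of [u]. *)
Lemma prod_one_sub_unity_root (F : fieldType) (e q : nat) (u y : F) :
  e.-primitive_root u ->
  \prod_(0 <= k < q * e) (1 - u ^+ k * y) = (1 - y ^+ e) ^+ q.
Proof.
move=> hu; elim: q => [|q IHq]; first by rewrite big_geq.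
rewrite mulSn (big_cat_nat (n := e)) ?leq_addr //= prod_one_sub_prim_root // exprS.
rewrite -[X in \prod_(X <= _ < _) _]add0n big_addn addKn -IHq; congr (_ * _); apply: eq_bigr => k _.
by rewrite exprD (prim_expr_order hu) mulr1.
Qed.

Lemma prod_non_multiples3 (R : comRingType) (f : nat -> R) (n : nat) :
  \prod_(x in D 3 n) f x = \prod_(0 <= k < n.+1) (f (3 * k + 1)%N * f (3 * k + 2)%N).
Proof.
have -> : \prod_(x in D 3 n) f x = \prod_(x < 3 * n + 3 | ~~ (3 %| x)%N) f x.
  apply: eq_bigl => x; rewrite inE; have := ltn_ord x; lia.
rewrite -(big_mkord (fun x => ~~ (3 %| x)%N)).
have -> : (3 * n + 3 = 3 * n.+1)%N by lia.
elim: n.+1 => [|k IHk]; first by rewrite muln0 !big_geq.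
rewrite big_nat_recr //= -IHk.
have -> : (3 * k.+1 = (3 * k).+3)%N by lia.
rewrite big_mkcond 3?big_nat_recr //= -big_mkcond /=.
have -> : (3 %| 3 * k)%N = true by lia.
have -> : (3 %| (3 * k).+1)%N = false by lia.
have -> : (3 %| (3 * k).+2)%N = false by lia.
by rewrite /= mulr1 mulrA addn1 addn2.
Qed.

(** * Discrete Fourier inversion *)

Lemma sum_subset_prod (R : comRingType) (T : finType) (A : {set T}) (g : T -> R) :
  \sum_(B : {set T} | B \subset A) \prod_(x in B) g x = \prod_(x in A) (1 + g x).
Proof.
rewrite [RHS]big_mkcond /=.
(* The value [0] outside [A] kills every [B] not contained in [A], so the product can be expanded
   over the whole type. *)
rewrite (eq_bigr (fun x => (if x \in A then g x else 0) + 1)); last first.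
  by move=> x _; case: ifP => _; rewrite ?add0r // addrC.
rewrite bigA_distr big_mkcond /=; apply: eq_bigr => B _.
rewrite -big_mkcond /=; case: ifP => [/fintype.subsetP sBA | /negbT/subsetPn[x xB xA]].
  by apply: eq_bigr => x /sBA ->.
by rewrite (bigD1 x) //= (negPf xA) mul0r.
Qed.

Lemma primitive_root_neq0 (F : fieldType) (N : nat) (w : F) :
  N.-primitive_root w -> w != 0.
Proof.
move=> hw; have := oner_neq0 F; rewrite -(prim_expr_order hw).
by rewrite expf_eq0 (prim_order_gt0 hw).
Qed.

(** Orthogonality of characters: if the ratio [t] is not 1, then [t^N = 1] makes its geometric sum
    vanish. *)
Lemma sum_prim_root_quotient (F : fieldType) (N a b : nat) (w : F) :
  N.-primitive_root w ->
  \sum_(j < N) (w ^+ a / w ^+ b) ^+ j = (a == b %[mod N])%:R * N%:R.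
Proof.
move=> hw; have wb0 : w ^+ b != 0 by rewrite expf_neq0 // (primitive_root_neq0 hw).
rewrite -(eq_prim_root_expr hw).
have [->|neq] := eqVneq (w ^+ a).
  rewrite divff // mul1r (eq_bigr (fun=> 1)) ?sumr_const ?card_ord // => j _.
  by rewrite expr1n.
rewrite mul0r; set t := _ / _; have t1 : t - 1 != 0.
  by rewrite subr_eq0; apply: contraNneq neq => /(canRL (mulfVK wb0)); rewrite mul1r => ->.
apply: (mulfI t1); rewrite -subrX1 mulr0 /t expr_div_n -!exprM !(mulnC _ N) !exprM.
by rewrite (prim_expr_order hw) !expr1n divr1 subrr.
Qed.

Lemma M1E (n : nat) (b : 'Z_(modulus 3 n)) :
  M 3 1 n b = \sum_(A : {set 'I_(3 * n + 3)} | (A \subset D 3 n) &&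
      (\sum_(x in A) x == b %[mod modulus 3 n])%N) (-1) ^+ #|A|.
Proof.
rewrite /M (reindex (fun A : {set 'I_(3 * n + 3)} => [ffun _ : 'I_1 => A])) /=; last first.
  exists (fun V : {ffun 'I_1 -> {set 'I_(3 * n + 3)}} => V ord0) => [A _|V _].
    by rewrite ffunE.
  by apply/ffunP => i; rewrite ffunE (ord1 i).
apply: eq_big => [A|A _]; last by rewrite big_ord1 ffunE.
rewrite big_ord1 ffunE; congr andb.
by apply/forallP/idP => [/(_ ord0)|sA i]; rewrite ffunE.
Qed.

(** Expanding the product over subsets [A] and exchanging the sums leaves a sum over [j] that
    detects whether [A] sums to [b] modulo [N]. *)
Lemma M_fourier (F : fieldType) (n : nat) (b : 'Z_(modulus 3 n)) (w : F) :
  (modulus 3 n).-primitive_root w ->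
  (modulus 3 n)%:R * (M 3 1 n b)%:~R =
  \sum_(j < modulus 3 n) (w ^+ b)^-1 ^+ j * \prod_(x in D 3 n) (1 - (w ^+ j) ^+ x).
Proof.
move=> hw; rewrite M1E rmorph_sum mulr_sumr /=.
under [RHS]eq_bigr => j _ do
  rewrite -(sum_subset_prod (D 3 n) (fun x => - (w ^+ j) ^+ x)) mulr_sumr.
rewrite exchange_big /= big_mkcondr /=; apply: eq_bigr => A _.
have -> : (if (\sum_(x in A) x == b %[mod modulus 3 n])%N
           then (modulus 3 n)%:R * ((-1) ^+ #|A|)%:~R else 0) =
  (-1) ^+ #|A| * ((\sum_(x in A) x == b %[mod modulus 3 n])%N%:R * (modulus 3 n)%:R) :> F.
  by case: ifP => _; rewrite ?mul0r ?mulr0 // mul1r rmorphXn rmorphN1 mulrC.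
rewrite -(sum_prim_root_quotient _ _ hw) mulr_sumr; apply: eq_bigr => j _.
rewrite prodrN prodrXr expr_div_n exprVn -!exprM !(mulnC j).
ring.
Qed.

(** * The product at an [N]-th root of unity *)

Lemma cube_root_unity_sum (F : fieldType) (y : F) :
  y ^+ 3 = 1 -> y != 1 -> 1 + y + y ^+ 2 = 0.
Proof.
move=> y3 y1; have y10 : y - 1 != 0 by rewrite subr_eq0.
have y31 : (y - 1) * (1 + y + y ^+ 2) = y ^+ 3 - 1 by ring.
by apply: (mulfI y10); rewrite y31 y3 subrr mulr0.
Qed.

Lemma prod_one_sub_D3 (F : fieldType) (n : nat) (z : F) :
  z ^+ modulus 3 n = 1 ->
  exists e, [/\ e.-primitive_root (z ^+ 3), (e %| n + 1)%N &
    \prod_(x in D 3 n) (1 - z ^+ x) =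
      if z ^+ e == 1 then 0 else 3%:R ^+ ((n + 1) %/ e)].
Proof.
move=> zN; have z3m : (z ^+ 3) ^+ (n + 1) = 1 by rewrite -exprM mulnC.
have m_gt0 : (0 < n + 1)%N by rewrite addn1.
have [e he e_dvd] := prim_order_exists m_gt0 z3m.
exists e; split=> //.
rewrite (prod_non_multiples3 (fun x => 1 - z ^+ x)) big_split /= -addn1.
(* Each of the two residue classes runs through [q] periods of [z^3], starting from [z] or from
   [z^2]. *)
rewrite -{1 2}(divnK e_dvd); set q := (_ %/ e)%N.
under eq_bigr => k _ do rewrite exprD exprM.
under [X in _ * X]eq_bigr => k _ do rewrite exprD exprM.
rewrite !(prod_one_sub_unity_root _ _ he) -exprMn expr1.
have : (z ^+ e) ^+ 3 = 1 by rewrite -exprM mulnC exprM (prim_expr_order he).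
have -> : (z ^+ 2) ^+ e = (z ^+ e) ^+ 2 by rewrite -!exprM mulnC.
set y := z ^+ e => y3.
have [->|y1] := eqVneq y 1.
  (* Since [0^0 = 1], the value 0 requires [q > 0]. *)
  rewrite subrr mul0r expr0n; suff -> : (q == 0)%N = false by [].
  apply/negbTE; rewrite -lt0n divn_gt0 ?(prim_order_gt0 he) //.
  by rewrite dvdn_leq // addn1.
congr (_ ^+ q).
have y2 := cube_root_unity_sum y3 y1.
have -> : (1 - y) * (1 - y ^+ 2) = 2 - (1 + y + y ^+ 2) + y ^+ 3 by ring.
rewrite y2 y3; ring.
Qed.

(** * Estimate of the Fourier sum *)

Lemma norm_prim_root_expr (N k : nat) (w : algC) :
  N.-primitive_root w -> `|w ^+ k| = 1.
Proof.
move=> hw; rewrite normrX.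
suff -> : `|w| = 1 by rewrite expr1n.
apply/eqP; rewrite -(pexpr_eq1 (prim_order_gt0 hw)) // -normrX.
by rewrite (prim_expr_order hw) normr1.
Qed.

(** With [m = n + 1], the first factor counts the indices left among the [3 * m] once [0], [m],
    [2 * m] and, for even [m], [N / 2] are removed. *)
Lemma M_estimate (n : nat) (b : 'Z_(modulus 3 n)) : ~~ (3 %| b)%N ->
  `|(modulus 3 n)%:R * M 3 1 n b + 3%:R ^+ (n + 1)|
    <= (3 * n - ~~ odd (n + 1))%:R * 3%:R ^+ (n + 1)./2.
Proof.
move=> b3; set m := (n + 1)%N; set N := modulus 3 n.
have N3 : N = (3 * m)%N by rewrite /N /modulus mulnC.
have m_gt0 : (0 < m)%N by rewrite /m addn1.
have [w hw] := C_prim_root_exists (isT : (0 < (N.-1).+1)%N).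
have {hw} hw : N.-primitive_root w.
  by move: hw; rewrite prednK // N3; lia.
rewrite -(ler_int algC) intr_norm.
have -> : ((3 * n - ~~ odd m)%:R * 3%:R ^+ m./2)%:~R
    = (3 * n - ~~ odd m)%:R * 3%:R ^+ m./2 :> algC.
  by rewrite rmorphM rmorphXn /= !rmorph_nat.
have -> : (N%:R * M 3 1 n b + 3%:R ^+ m)%:~R
    = N%:R * (M 3 1 n b)%:~R + 3%:R ^+ m :> algC.
  by rewrite rmorphD rmorphM rmorphXn /= !rmorph_nat.
rewrite (M_fourier b hw).
set f := fun j : nat => (w ^+ b)^-1 ^+ j * \prod_(x in D 3 n) (1 - (w ^+ j) ^+ x).
have -> : \sum_(j < N) (w ^+ b)^-1 ^+ j * \prod_(x in D 3 n) (1 - (w ^+ j) ^+ x)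
          = \sum_(j <- iota 0 N) f j.
  by rewrite -[N in iota _ N]subn0 -/(index_iota 0 N) big_mkord.
(* The factor with exponent 2 vanishes; this serves [j = 0] and [j = N / 2]. *)
have f_eq0 j : (N %| j * 2)%N -> f j = 0.
  rewrite (prim_order_dvd hw) exprM => /eqP wj2.
  have lt2 : (2 < 3 * n + 3)%N by lia.
  have D2 : Ordinal lt2 \in D 3 n by rewrite inE /=; lia.
  by rewrite /f (bigD1 _ D2) /= wj2 subrr mul0r mulr0.
have f_le j : ~~ (m %| j)%N -> `|f j| <= 3%:R ^+ m./2.
  move=> mj; have zN : (w ^+ j) ^+ N = 1.
    by rewrite -exprM mulnC exprM (prim_expr_order hw) expr1n.
  have [e [he e_dvd Fz]] := prod_one_sub_D3 zN.
  rewrite /f normrM exprVn -exprM normfV (norm_prim_root_expr _ hw) invr1 mul1r Fz.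
  case: ifP => _; first by rewrite normr0 exprn_ge0 ?ler0n.
  rewrite normrX normr_nat ler_eXn2l ?ltr1n //.
  (* If [e = 1], then [N] divides [3 * j], so [m] divides [j]. *)
  have e1 : e != 1%N.
    apply: contra mj => /eqP e1; move: he; rewrite e1 => /prim_expr_order.
    rewrite expr1 -exprM => /eqP; rewrite -(prim_order_dvd hw) N3 mulnC.
    by rewrite dvdn_pmul2r.
  have e_gt0 := prim_order_gt0 he.
  by rewrite -divn2 leq_div2l //; lia.
have f_main : f m + f (2 * m)%N = - 3%:R ^+ m.
  have Fz j : (N %| j * 3)%N -> ~~ (N %| j)%N ->
      \prod_(x in D 3 n) (1 - (w ^+ j) ^+ x) = 3%:R ^+ m.
    rewrite !(prim_order_dvd hw) => /eqP wj3 wj1.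
    have zN : (w ^+ j) ^+ N = 1.
      by rewrite -exprM mulnC exprM (prim_expr_order hw) expr1n.
    have [e [he e_dvd ->]] := prod_one_sub_D3 zN.
    move: he; rewrite -exprM wj3 => he.
    have e1 : e = 1%N.
      by apply/eqP; rewrite -dvdn1 (prim_order_dvd he) expr1n.
    by rewrite e1 expr1 (negPf wj1) divn1.
  rewrite /f Fz ?[X in _ + X](_ : _ = (w ^+ b)^-1 ^+ (2 * m) * 3%:R ^+ m); first last.
  - by rewrite N3 gtnNdvd //; lia.
  - by rewrite N3 mulnC.
  - rewrite Fz // N3; first by apply/dvdnP; exists 2%N; lia.
    by rewrite gtnNdvd //; lia.
  (* The phases at [m] and [2 * m] are [c] and [c^2], with [c] a nontrivial cube root of unity
     because 3 does not divide [b]; they add up to [-1]. *)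
  set c := (w ^+ b)^-1 ^+ m.
  have c3 : c ^+ 3 = 1.
    by rewrite /c !exprVn -!exprM [(m * 3)%N]mulnC -N3 mulnC exprM
         (prim_expr_order hw) expr1n invr1.
  have c1 : c != 1.
    rewrite /c exprVn invr_eq1 -exprM -(prim_order_dvd hw) N3.
    by rewrite dvdn_pmul2r.
  rewrite mulnC exprM -/c.
  have c2 := cube_root_unity_sum c3 c1.
  transitivity ((1 + c + c ^+ 2) * 3%:R ^+ m - 3%:R ^+ m); first by ring.
  by rewrite c2 mul0r sub0r.
pose s := [:: 0; m; 2 * m]%N ++ nseq (~~ odd m) (3 * m./2)%N.
have s_uniq : uniq s.
  rewrite /s; case: (boolP (odd m)) => odd_m /=; rewrite !inE; lia.
have s_lt j : j \in s -> (j < N)%N.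
  rewrite N3 /s; case: (boolP (odd m)) => odd_m; rewrite /= !inE; lia.
have s_perm : perm_eq [seq j <- iota 0 N | j \in s] s.
  apply: uniq_perm => //; first by rewrite filter_uniq ?iota_uniq.
  move=> j; rewrite mem_filter mem_iota add0n.
  by case: (boolP (j \in s)) => // /s_lt ->.
have s_sum : \sum_(j <- s) f j = - 3%:R ^+ m.
  rewrite /s big_cat /= !big_cons big_nil f_eq0 ?dvdn0 // add0r addr0 f_main.
  case: (boolP (odd m)) => odd_m /=; first by rewrite big_nil addr0.
  rewrite big_seq1 f_eq0 ?addr0 // N3.
  by have -> : (3 * m./2 * 2 = 3 * m)%N by lia.
rewrite (bigID (fun j => j \in s)) /= -big_filter (perm_big _ s_perm) /= s_sum.
rewrite addrAC addNr add0r -big_filter.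
set r := [seq _ <- _ | _].
have -> : (3 * n - ~~ odd m)%N = size r.
  have := count_predC (fun j => j \in s) (iota 0 N).
  rewrite -!size_filter (perm_size s_perm) -/r size_iota /s size_cat size_nseq /= N3.
  rewrite /m; lia.
apply: le_trans (ler_norm_sum _ _ _) _.
apply: (@le_trans _ _ (\sum_(j <- r) 3%:R ^+ m./2)).
  (* The multiples of [m] below [3 * m] all lie in [s], so [f_le] applies to the rest. *)
  rewrite !big_seq; apply: ler_sum => j; rewrite mem_filter => /andP[js].
  rewrite mem_iota add0n => jN; apply: f_le; apply: contra js => /dvdnP[k jk].
  move: jN; rewrite jk N3 ltn_pmul2r // => k3.
  by case: k k3 {jk} => [|[|[|]]] // _; rewrite /s /= !inE ?mul0n ?mul1n eqxx ?orbT.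
by rewrite big_const_seq count_predT iter_addr_0 mulr_natl.
Qed.

(** * Comparison of the error with the main term *)

Lemma leq_sqr_exp3 (k : nat) : (k ^ 2 <= 3 ^ k)%N.
Proof.
elim: k => [|[|[|k]] IHk] //.
rewrite expnS; apply: leq_trans (leq_mul (leqnn 3) IHk); nia.
Qed.

Lemma error_lt_main (n : nat) : (0 < n)%N ->
  ((3 * n - ~~ odd (n + 1)) * 3 ^ (n + 1)./2 < 3 ^ (n + 1))%N.
Proof.
move=> n_gt0.
have -> : (3 ^ (n + 1) = 3 ^ (n + 1 - (n + 1)./2) * 3 ^ (n + 1)./2)%N.
  by rewrite -expnD; congr expn; lia.
rewrite ltn_pmul2r ?expn_gt0 //.
(* For [n = 2 * k + 1] the count is [6 * k + 2]; the bound is tight at [k = 0] and [k = 1], where it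
   reads [2 < 3] and [8 < 9]. *)
have even_case k : (6 * k + 2 < 3 ^ k.+1)%N.
  elim: k => // k IHk; rewrite expnS; lia.
have [k [n_eq | n_eq]] : exists k, n = (2 * k + 1)%N \/ n = (2 * k).+2.
  by exists (n.-1./2); lia.
- have -> : (n + 1 - (n + 1)./2 = k.+1)%N by lia.
  by apply: leq_ltn_trans (even_case k); lia.
- have -> : (n + 1 - (n + 1)./2 = k.+2)%N by lia.
  by rewrite expnS; have := even_case k; lia.
Qed.

(** Makes the relative error [O(1/n)]. From [n + 1 <= 2 * k], the count times [n + 1] is at most
    [3 * (2 * k)^2 = 12 * k^2], hence the constant 12. *)
Lemma error_leq_main (n : nat) :
  ((3 * n - ~~ odd (n + 1)) * 3 ^ (n + 1)./2 * (n + 1) <= 12 * 3 ^ (n + 1))%N.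
Proof.
set k := (n + 1 - (n + 1)./2)%N.
have -> : (3 ^ (n + 1) = 3 ^ k * 3 ^ (n + 1)./2)%N by rewrite -expnD; congr expn; lia.
have k_ge : (n + 1 <= 2 * k)%N by lia.
rewrite mulnAC mulnA leq_pmul2r ?expn_gt0 //.
apply: leq_trans (leq_mul (leqnn 12) (leq_sqr_exp3 k)).
apply: (@leq_trans (3 * (2 * k) * (2 * k))); first by apply: leq_mul; lia.
nia.
Qed.

(** * Sign and asymptotics *)

Theorem theorem4p3 (R : realType) :
  (forall b : forall n : nat, 'Z_(modulus 3 n),
     (forall n : nat, (0 < n)%N ->
        (b n = 1 %[mod 3])%N \/ (b n = 2 %[mod 3])%N) ->
     exists o : nat -> R,
       (o n @[n --> \oo] --> (0 : R)) /\
       (forall n : nat, (0 < n)%N ->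
          (M 3 1 n (b n))%:~R = - (3%:R ^+ n / (n + 1)%:R) * (1 + o n)))
  /\
  (forall (n : nat) (b : 'Z_(modulus 3 n)), (0 < n)%N ->
     (b = 1 %[mod 3])%N \/ (b = 2 %[mod 3])%N ->
     M 3 1 n b < 0).
Proof.
split=> [b hb|n b n_gt0 hb]; last first.
  have b3 : ~~ (3 %| b)%N by lia.
  (* Together these give [N * M + 3^(n + 1) < 3^(n + 1)]. *)
  have := M_estimate b3; have := error_lt_main n_gt0.
  rewrite -(ltr_nat int) natrM !natrX => lt_main /ler_normlP[_ /le_lt_trans/(_ lt_main)].
  rewrite gtrDr pmulr_rlt0 // ltr0n /modulus; lia.
(* At [n = 0] the hypothesis says nothing on [b 0], hence the separate value. *)
pose o n : R := if n is 0 then 0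
  else - ((n + 1)%:R * (M 3 1 n (b n))%:~R / 3%:R ^+ n) - 1.
exists o; split=> [|[|n] // _]; last first.
  rewrite /o; field.
  by rewrite expf_neq0 ?pnatr_eq0 //= -natr1 -(natrD _ 1) pnatr_eq0 addn1.
(* For [n > 0], [o n] is minus the quantity bounded in [M_estimate], divided by [3^(n + 1)]. *)
have o_le n : `|o n| <= 12%:R * (n.+1%:R)^-1.
  case: n => [|n]; first by rewrite /= normr0 mulr_ge0.
  rewrite /o; set m := n.+1.
  have b3 : ~~ (3 %| b m)%N by have := hb m isT; lia.
  have p3 : 0 < 3%:R ^+ (m + 1) :> R by rewrite exprn_gt0.
  have -> : - ((m + 1)%:R * (M 3 1 m (b m))%:~R / 3 ^+ m) - 1
    = - ((modulus 3 m)%:R * M 3 1 m (b m) + 3 ^+ (m + 1))%:~R / 3%:R ^+ (m + 1) :> R.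
    have -> : ((modulus 3 m)%:R * M 3 1 m (b m) + 3 ^+ (m + 1))%:~R
      = (m + 1)%:R * 3 * (M 3 1 m (b m))%:~R + 3 ^+ (m + 1) :> R.
      by rewrite rmorphD rmorphM rmorphXn /= !rmorph_nat natrM.
    by rewrite addn1 exprS; field; rewrite expf_neq0.
  rewrite normrM normrN normfV [`|3%:R ^+ _|]gtr0_norm // ler_pdivrMr //.
  rewrite [X in _ <= X]mulrAC ler_pdivlMr ?ltr0n // -[m.+1]addn1.
  apply: (@le_trans _ _ ((3 * m - ~~ odd (m + 1))%:R * 3%:R ^+ (m + 1)./2 * (m + 1)%:R)).
    rewrite ler_pM2r ?ltr0n ?addn1 //.
    have := M_estimate b3; rewrite -(ler_int R) intr_norm addn1.
    by rewrite [X in _ <= X -> _]rmorphM rmorphXn /= !rmorph_nat.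
  by rewrite -!natrX -!natrM ler_nat error_leq_main.
have bound_cvg : (12%:R * (n.+1%:R)^-1 : R) @[n --> \oo] --> (0 : R).
  by rewrite -[X in _ --> X](mulr0 12%:R); apply: cvgM (cvg_cst _) cvg_harmonic.
apply: (squeeze_cvgr _ _ bound_cvg); last by rewrite -oppr0; apply: cvgN bound_cvg.
by apply: nearW => n; rewrite -ler_norml.
Qed.
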